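(* Let $a,b\in\operatorname{Alg}\mathcal{N}$ be such that $M_{a,b}\neq 0$. (i) In the case $R_{a+}\neq Q_b$: the multiplication operator $M_{a,b}:\operatorname{Alg}\mathcal{N}\to\operatorname{Alg}\mathcal{N}$ is compact if and only if for every $P\in\mathcal{N}$ with $R_a<P<Q_b$ the operators $P_+aP_+$ and $P_-^{\perp}bP_-^{\perp}$ are both compact. (ii) In the case $R_{a+}=Q_b$: $M_{a,b}$ is compact if and only if the operators $Q_baQ_b$ and $R_a^{\perp}bR_a^{\perp}$ are both compact.
   Context: $\mathcal{N}$ is a nest on a Hilbert space $H$: a totally ordered family of closed subspaces of $H$ containing $\{0\}$ and $H$ and closed under intersections and closed linear spans of arbitrary subfamilies. Subspaces in $\mathcal{N}$ are identified with their orthogonal projections; $P^{\perp}=I-P$. $\operatorname{Alg}\mathcal{N}$ is the algebra of all bounded operators $T$ on $H$ with $T(N)\subseteq N$ for all $N\in\mathcal{N}$. $\vee$ denotes closed linear span and $\wedge$ intersection of families of subspaces. For $N\in\mathcal{N}$: $N_-=\vee\{N'\in\mathcal{N}:N'<N\}$ and $N_+=\wedge\{N'\in\mathcal{N}:N'>N\}$ (with $\{0\}_-=\{0\}$, $H_+=H$); $P_-^\perp$ means $(P_-)^\perp$ and $R_{a+}$ means $(R_a)_+$. For $a,b\in\operatorname{Alg}\mathcal{N}$, $M_{a,b}:\operatorname{Alg}\mathcal{N}\to\operatorname{Alg}\mathcal{N}$ is the map $M_{a,b}(x)=axb$, and $$R_a=\vee\{P\in\mathcal{N}:aP=0\},\qquad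 Q_b=\wedge\{P\in\mathcal{N}:P^{\perp}b=0\}.$$ *)

(* Defs.v *)
From HB Require Import structures.
From mathcomp Require Import all_boot all_order all_algebra.
From mathcomp Require Import sesquilinear complex.
From mathcomp Require Import all_classical all_reals all_analysis.

Set Implicit Arguments.
Unset Strict Implicit.
Unset Printing Implicit Defensive.

Set Warnings "-redundant-canonical-projection -projection-no-head-constant".
Import Order.TTheory GRing.Theory Num.Theory.
Import numFieldNormedType.Exports.
Local Open Scope classical_set_scope.
Local Open Scope complex_scope.
Local Open Scope ring_scope.

HB.mixin Record isHilbert (R : realType) H
    & CompleteNormedModule R[i] H := {
  inner : {dot H for @Num.conj R[i]} ;
  inner_norm : forall x : H, `|x| ^+ 2 = inner x x }.

#[short(type="hilbertType")]
HB.structure Definition Hilbert (R : realType) :=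
  {H of CompleteNormedModule R[i] H & isHilbert R H}.

Definition unit_ball (K : numFieldType) (V : normedModType K) : set V :=
  [set x | `|x| <= 1].

(* Intended for linear f only. *)
Definition compact_op (K : numFieldType) (V W : normedModType K)
  (f : V -> W) : Prop := precompact (f @` @unit_ball K V).

Section BoundedOperators.
Context (R : realType) (V : normedModType R[i]).

Definition bounded_linear : {pred V -> V} :=
  fun f => `[< linear f /\ continuous f >].

Record bop := Bop { bop_fun :> V -> V ; _ : bop_fun \in bounded_linear }.
HB.instance Definition _ := [isSub for bop_fun].
HB.instance Definition _ := [Choice of bop by <:].

Lemma bopP (f : bop) : linear f /\ continuous f.
Proof. by case: f => f /= /asboolP. Qed.

Let bounded_linear_submod : submod_closed bounded_linear.
Proof.
split.
  apply/asboolP; split.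
    by move=> k x y; rewrite /= scaler0 addr0.
  exact: cst_continuous.
move=> k f g /asboolP[lf cf] /asboolP[lg cg]; apply/asboolP; split.
  move=> c x y; rewrite -[LHS]/(k *: f (c *: x + y) + g (c *: x + y)).
  rewrite lf lg -[RHS]/(c *: (k *: f x + g x) + (k *: f y + g y)).
  by rewrite !scalerDr !scalerA (mulrC k) addrACA.
move=> x; apply: (@cvgD _ _ _ _ _ (fun z => k *: f z) g (k *: f x)).
  by apply: cvgZl_tmp; exact: cf.
exact: cg.
Qed.
HB.instance Definition _ :=
  GRing.isSubmodClosed.Build _ _ bounded_linear bounded_linear_submod.
HB.instance Definition _ := [SubChoice_isSubLmodule of bop by <:].

Let values (f : bop) : set R :=
  [set complex.Re `|f x| | x in @unit_ball R[i] V].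

Definition opnorm (f : bop) : R[i] := (sup (values f))%:C.

Let ReK (z : R[i]) : 0 <= z -> (complex.Re z)%:C = z.
Proof. by case: z => u v; rewrite lecE /= => /andP[/eqP -> _]. Qed.

Lemma bop0 (f : bop) : f 0 = 0.
Proof.
by have [lf _] := bopP f; have := lf (-1) 0 0; rewrite !scaleN1r !addNr.
Qed.

Lemma bopZ (f : bop) k x : f (k *: x) = k *: f x.
Proof.
by have [lf _] := bopP f; have := lf k x 0; rewrite !addr0 bop0 addr0.
Qed.

Let has_sup_values (f : bop) : has_sup (values f).
Proof.
split; first by exists (complex.Re `|f 0|), 0 => //=; rewrite /unit_ball/= normr0.
have [lf cf] := bopP f.
pose g : {linear V -> V} := HB.pack (f : V -> V) (GRing.isLinear.Build _ _ _ _ _ lf).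
have /linear_boundedP bg : bounded_near g (nbhs 0).
  by apply/linear_bounded_continuous.
have [M [Mr /= bM]] := bg.
pose M' := `|M| + 1.
have M'M : M < M' by rewrite (le_lt_trans (real_ler_norm Mr))// ltrDl.
have M'0 : 0 <= M' by rewrite addr_ge0.
exists (complex.Re M') => _ [x /= x1 <-].
have : `|f x| <= M' by rewrite (le_trans (bM _ M'M x))// ler_piMr.
by rewrite lecE => /andP[].
Qed.

Lemma le_opnorm1 (f : bop) x : `|x| <= 1 -> `|f x| <= opnorm f.
Proof.
move=> x1; rewrite -(ReK (normr_ge0 (f x))) /opnorm lecR.
by apply: sup_upper_bound => //; exists x.
Qed.

Lemma opnorm_le (f : bop) (M : R[i]) :
  (forall x, `|x| <= 1 -> `|f x| <= M) -> opnorm f <= M.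
Proof.
move=> fM.
have M0 : 0 <= M by rewrite (le_trans _ (fM 0 _)) ?normr0.
rewrite -(ReK M0) /opnorm lecR; apply: ge_sup.
  by have [] := has_sup_values f.
by move=> _ [x /= x1 <-]; have := fM x x1; rewrite lecE => /andP[].
Qed.

Lemma opnorm_ge0 (f : bop) : 0 <= opnorm f.
Proof. by rewrite (le_trans _ (le_opnorm1 f (x:=0) _)) ?normr0. Qed.

Lemma le_opnorm (f : bop) x : `|f x| <= opnorm f * `|x|.
Proof.
have [->|x0] := eqVneq x 0; first by rewrite bop0 !normr0 mulr0.
have nx : 0 < `|x| by rewrite normr_gt0.
have : `|f (`|x|^-1 *: x)| <= opnorm f.
  by apply: le_opnorm1; rewrite normrZ normfV normr_id mulVf ?gt_eqF.
by rewrite bopZ normrZ normfV normr_id mulrC ler_pdivrMr.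
Qed.

Let opnormD (f g : bop) : opnorm (f + g) <= opnorm f + opnorm g.
Proof.
apply: opnorm_le => x x1; rewrite -[(f + g) x]/(f x + g x).
by rewrite (le_trans (ler_normD _ _))// lerD// le_opnorm1.
Qed.

Let opnormZ_le (k : R[i]) (f : bop) : opnorm (k *: f) <= `|k| * opnorm f.
Proof.
apply: opnorm_le => x x1; rewrite -[(k *: f) x]/(k *: f x) normrZ.
by rewrite ler_wpM2l// le_opnorm1.
Qed.

Let opnormZ (k : R[i]) (f : bop) : opnorm (k *: f) = `|k| * opnorm f.
Proof.
apply/le_anti; rewrite opnormZ_le /=.
have [->|k0] := eqVneq k 0; first by rewrite normr0 mul0r opnorm_ge0.
have := opnormZ_le k^-1 (k *: f).
rewrite scalerA mulVf// scale1r normfV mulrC ler_pdivlMr ?normr_gt0//.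
by rewrite mulrC.
Qed.

Let opnorm_eq0 (f : bop) : opnorm f = 0 -> f = 0.
Proof.
move=> fn; apply/val_inj/funext => x /=; apply/eqP.
by have := le_opnorm f x; rewrite fn mul0r normr_le0.
Qed.

HB.instance Definition _ :=
  Lmodule_isNormed.Build R[i] bop opnormD opnormZ opnorm_eq0.

Let bop_mul_subproof (f g : bop) : (f \o g : V -> V) \in bounded_linear.
Proof.
have [lf cf] := bopP f; have [lg cg] := bopP g.
apply/asboolP; split; first by move=> k x y /=; rewrite lg lf.
by move=> x; apply: continuous_comp; [exact: cg|exact: cf].
Qed.
Definition bop_mul (f g : bop) : bop := Bop (bop_mul_subproof f g).

End BoundedOperators.

Section Subspaces.
Context (K : numFieldType) (V : normedModType K).

Definition subspace_set (P : set V) : Prop :=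
  P 0 /\ forall k x y, P x -> P y -> P (k *: x + y).

Definition closed_span (A : set V) : set V :=
  closure (smallest subspace_set A).

Definition nest_vee (S : set (set V)) : set V :=
  closed_span (\bigcup_(P in S) P).
Definition nest_wedge (S : set (set V)) : set V := \bigcap_(P in S) P.

Record is_nest (N : set (set V)) : Prop := {
  nest_subspace : forall P, N P -> subspace_set P /\ closed P ;
  nest_total : forall P Q, N P -> N Q -> P `<=` Q \/ Q `<=` P ;
  nest_0 : N [set 0] ;
  nest_T : N setT ;
  nest_closed_wedge : forall S, S `<=` N -> N (nest_wedge S) ;
  nest_closed_vee : forall S, S `<=` N -> N (nest_vee S) }.

Record nest := Nest {
  nest_sets :> set V -> Prop ;
  nestP : is_nest nest_sets }.

(* P_- and P_+ *)
Definition nest_pred (N : nest) (P : set V) : set V :=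
  nest_vee [set P' | N P' /\ P' `<` P].
Definition nest_succ (N : nest) (P : set V) : set V :=
  nest_wedge [set P' | N P' /\ P `<` P'].
End Subspaces.

Section NestAlgebra.
Context (R : realType) (V : normedModType R[i]) (N : nest V).

Definition nest_invariant : {pred bop V} :=
  fun T => `[< forall P, N P -> T @` P `<=` P >].

Record alg := Alg { alg_bop :> bop V ; _ : alg_bop \in nest_invariant }.
HB.instance Definition _ := [isSub for alg_bop].
HB.instance Definition _ := [Choice of alg by <:].

Let nest_invariant_submod : submod_closed nest_invariant.
Proof.
split.
  apply/asboolP => P /(nest_subspace (nestP N))[[P0 _] _] _ [x _ <-].
  exact: P0.
move=> k f g /asboolP Nf /asboolP Ng; apply/asboolP => P NP _ [x Px <-].
have [[_ PD] _] := nest_subspace (nestP N) NP.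
by apply: PD; [apply: (Nf P NP); exists x|apply: (Ng P NP); exists x].
Qed.
HB.instance Definition _ :=
  GRing.isSubmodClosed.Build _ _ nest_invariant nest_invariant_submod.
HB.instance Definition _ := [SubChoice_isSubLmodule of alg by <:].

Definition alg_norm (T : alg) : R[i] := `|alg_bop T|.

Let alg_normD (f g : alg) : alg_norm (f + g) <= alg_norm f + alg_norm g.
Proof. exact: ler_normD. Qed.
Let alg_normZ (k : R[i]) (f : alg) : alg_norm (k *: f) = `|k| * alg_norm f.
Proof. exact: normrZ. Qed.
Let alg_norm_eq0 (f : alg) : alg_norm f = 0 -> f = 0.
Proof. by move=> /eqP; rewrite normr_eq0 => /eqP f0; exact/val_inj. Qed.

HB.instance Definition _ :=
  Lmodule_isNormed.Build R[i] alg alg_normD alg_normZ alg_norm_eq0.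

Let alg_mul_subproof (f g : alg) : bop_mul f g \in nest_invariant.
Proof.
case: f g => f /= /asboolP Nf [g /= /asboolP Ng].
apply/asboolP => P NP _ [x Px <-] /=.
by apply: (Nf P NP); exists (g x) => //; apply: (Ng P NP); exists x.
Qed.
Definition alg_mul (f g : alg) : alg := Alg (alg_mul_subproof f g).

(* M_{a,b} *)
Definition mulop (a b x : alg) : alg := alg_mul (alg_mul a x) b.
End NestAlgebra.

Section Projections.
Context (R : realType) (H : hilbertType R).

(* By the projection theorem the set below is a singleton when P is a closed
   subspace; the default value 0 is then irrelevant. *)
Definition oproj (P : set H) (x : H) : H :=
  xget 0 [set y | P y /\ forall z, P z -> inner (x - y) z = 0].

(* P^perp = I - P *)
Definition oproj_perp (P : set H) (x : H) : H := x - oproj P x.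

Definition Rspace (N : nest H) (a : alg N) : set H :=
  nest_vee [set P | N P /\ (a : H -> H) \o oproj P = cst 0].

Definition Qspace (N : nest H) (b : alg N) : set H :=
  nest_wedge [set P | N P /\ oproj_perp P \o (b : H -> H) = cst 0].

Definition corner (p : H -> H) (T : H -> H) : H -> H := p \o T \o p.
End Projections.

(* Main.v *)
(* Compactness of a map f on a set D is handled as total boundedness: for each
   e > 0 the points of D can be coloured with finitely many colours so that
   points of the same colour have images at distance at most e.

   Only if: e ⊗ f : v |-> <v, f> e lies in Alg N whenever e is in P and f is
   orthogonal to P_-, and a (e ⊗ f) b = ae ⊗ b*f.  Fixing f with b*f <> 0 and
   letting e vary shows that a is compact on P; fixing e with ae <> 0 and letting
   f vary gives compactness of P_-^perp b, by Schauder's argument.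

   If: x |-> A x B is compact when A and B are.  Every x in Alg N is upper
   triangular, so axb differs from (aP'') x (P'^perp b) by terms bounded by
   |aP'| and |P''^perp b|.  One can take P' close to R_a and P'' close to Q_b:
   either the limit is attained, or a compact operator vanishing on
   R_a = R_a+ has small norm on P' near R_a, since R_a^perp is then the closure
   of the union of the P'^perp (and dually for b at Q_b). *)
Require Import Defs.
From mathcomp Require Import all_boot all_order all_algebra.
From mathcomp Require Import sesquilinear complex.
From mathcomp Require Import all_classical all_reals all_analysis.
From mathcomp Require Import finmap ring.
Import Order.TTheory GRing.Theory Num.Theory.
Import numFieldNormedType.Exports.
Local Open Scope classical_set_scope.
Local Open Scope complex_scope.
Local Open Scope ring_scope.

(** * Hilbert spaces *)

Section InnerProduct.
Context {R : realType} {H : hilbertType R}.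
Implicit Types (x y z : H) (k : R[i]).

Lemma innerDl x y z : inner (x + y) z = inner x z + inner y z.
Proof. exact: linearDl. Qed.

Lemma innerNl x z : inner (- x) z = - inner x z.
Proof. exact: linearNl. Qed.

Lemma inner0l x : inner 0 x = 0.
Proof. exact: linear0l. Qed.

Lemma innerBl x y z : inner (x - y) z = inner x z - inner y z.
Proof. exact: linearBl. Qed.

Lemma innerZl k x z : inner (k *: x) z = k * inner x z.
Proof. exact: linearZl_LR. Qed.

Lemma innerBr x y z : inner z (x - y) = inner z x - inner z y.
Proof. exact: linearBr. Qed.

Lemma innerDr x y z : inner z (x + y) = inner z x + inner z y.
Proof. exact: linearDr. Qed.

Lemma innerZr k x z : inner z (k *: x) = Num.conj k * inner z x.
Proof. exact: linearZr_LR. Qed.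

Lemma inner0r x : inner x 0 = 0.
Proof. exact: linear0r. Qed.

Lemma innerC x y : inner x y = Num.conj (inner y x).
Proof. by rewrite hermC expr0 mul1r. Qed.

Lemma inner_eq0C x y : inner x y = 0 -> inner y x = 0.
Proof. by move=> xy0; rewrite innerC xy0 rmorph0. Qed.

Lemma inner_eq0 x : inner x x = 0 -> x = 0.
Proof.
by rewrite -inner_norm => /eqP; rewrite expf_eq0 /= normr_eq0 => /eqP.
Qed.

Lemma pythagoras x y : inner x y = 0 -> `|x + y| ^+ 2 = `|x| ^+ 2 + `|y| ^+ 2.
Proof.
move=> xy0; rewrite !inner_norm innerDl !innerDr xy0 (inner_eq0C _ _ xy0).
by rewrite addr0 add0r.
Qed.

(** Pythagoras for x split along z. Cauchy-Schwarz drops the first term; the projection theorem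
    bounds the second. *)
Lemma inner_decomp x z : z != 0 -> let t := inner x z / `|z| ^+ 2 in
  `|x| ^+ 2 = `|x - t *: z| ^+ 2 + `|inner x z| ^+ 2 / `|z| ^+ 2.
Proof.
move=> z0 t; have nz : `|z| ^+ 2 != 0 by rewrite expf_eq0 /= normr_eq0.
have o : inner (x - t *: z) (t *: z) = 0.
  by rewrite innerZr innerBl innerZl -inner_norm /t divfK// subrr mulr0.
rewrite -{1}(subrK (t *: z) x) (pythagoras _ _ o) normrZ exprMn /t normrM exprMn.
congr (_ + _); rewrite normfV (ger0_norm (exprn_ge0 2 (normr_ge0 z))).
by rewrite exprVn -mulrA [X in _ * X](_ : _ = (`|z| ^+ 2)^-1)// expr2 invfM divfK.
Qed.

Lemma cauchy_schwarz x z : `|inner x z| <= `|x| * `|z|.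
Proof.
have [->|z0] := eqVneq z 0; first by rewrite inner0r !normr0 mulr0.
rewrite -(@ler_pXn2r _ 2) ?nnegrE ?mulr_ge0 ?normr_ge0//.
have nz : 0 < `|z| ^+ 2 by rewrite exprn_gt0// normr_gt0.
rewrite exprMn -ler_pdivrMr// (inner_decomp x z z0) lerDr.
by rewrite exprn_ge0.
Qed.

Lemma parallelogram x y :
  `|x - y| ^+ 2 + `|x + y| ^+ 2 = 2 * (`|x| ^+ 2 + `|y| ^+ 2).
Proof.
rewrite !inner_norm !innerBl !innerDl !innerBr !innerDr.
move: (inner x x) (inner y y) (inner x y) (inner y x) => a b c d.
by ring.
Qed.

End InnerProduct.

(** * Infima of nonnegative complex numbers *)

Section Infimum.
Context {R : realType}.

Lemma ge0_ReK (z : R[i]) : 0 <= z -> (complex.Re z)%:C = z.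
Proof. by case: z => u v; rewrite lecE /= => /andP[/eqP -> _]. Qed.

(** Norms take values in [R[i]], whose order is only partial. Nonnegative elements have no imaginary
    part, so the infimum can be formed on real parts. *)
Lemma complex_inf (D : set R[i]) : D !=set0 -> (forall d, D d -> 0 <= d) ->
  exists m, (forall d, D d -> m <= d) /\
    forall e, 0 < e -> exists2 d, D d & d < m + e.
Proof.
move=> [d0 Dd0] D0.
have hD : has_inf (@complex.Re R @` D).
  split; first by exists (complex.Re d0), d0.
  by exists 0 => _ [d /D0 + <-]; rewrite lecE => /andP[].
exists (inf (@complex.Re R @` D))%:C; split.
  move=> d Dd; rewrite -(ge0_ReK d (D0 d Dd)) lecR.
  by apply: ge_inf; [case: hD | exists d].
move=> e e0; rewrite -(ge0_ReK e (ltW e0)).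
have e0' : 0 < complex.Re e by rewrite -ltcR (ge0_ReK e (ltW e0)).
have [_ [d Dd <-] dlt] := inf_adherent e0' hD.
by exists d => //; rewrite -(ge0_ReK d (D0 d Dd)) -rmorphD ltcR.
Qed.

End Infimum.

(** * The projection theorem *)

Section Projection.
Context {R : realType} {H : hilbertType R}.
Implicit Types (x y z : H) (P : set H).

Lemma subspaceD P x y : subspace_set P -> P x -> P y -> P (x + y).
Proof. by move=> [_ PD] Px Py; have := PD 1 _ _ Px Py; rewrite scale1r. Qed.

Lemma subspaceZ P (k : R[i]) x : subspace_set P -> P x -> P (k *: x).
Proof. by move=> [P0 PD] Px; have := PD k _ _ Px P0; rewrite addr0. Qed.

Lemma subspaceB P x y : subspace_set P -> P x -> P y -> P (x - y).
Proof.
move=> sP Px Py; apply: subspaceD => //; rewrite -scaleN1r.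
exact: subspaceZ.
Qed.

(** The almost-minimizers of the distance to x form a filter base, and the parallelogram law makes
    the filter Cauchy. Orthogonality holds approximately at almost-minimizers and passes to the
    limit y. *)
Lemma projection_theorem P x : subspace_set P -> closed P ->
  exists2 y, P y & forall z, P z -> inner (x - y) z = 0.
Proof.
move=> sP cP; have P0 : P 0 by case: sP.
have [||m [mle mlt]] := @complex_inf R [set `|x - p| ^+ 2 | p in P].
- by exists (`|x - 0| ^+ 2), 0.
- by move=> _ [p _ <-]; rewrite exprn_ge0.
pose A (e : R[i]) := [set p | P p /\ `|x - p| ^+ 2 < m + e].
pose F := filter_from [set e : R[i] | 0 < e] A.
have A_close e p q : A e p -> A e q -> `|p - q| ^+ 2 <= 4 * e.
  move=> [Pp pe] [Pq qe].
  (* The midpoint of p and q lies in P, so its squared distance from x is at least m. *)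
  have /mle : [set `|x - p| ^+ 2 | p in P] (`|x - 2^-1 *: (p + q)| ^+ 2).
    exists (2^-1 *: (p + q)) => //.
    exact: (subspaceZ P _ _ sP (subspaceD P _ _ sP Pp Pq)).
  have := parallelogram (x - p) (x - q).
  have -> : x - p - (x - q) = q - p by rewrite opprB addrC addrA subrK.
  have -> : x - p + (x - q) = 2 *: (x - 2^-1 *: (p + q)).
    rewrite scalerBr scalerA mulfV// scale1r scaler_nat mulr2n opprD.
    by rewrite addrACA.
  rewrite normrZ exprMn distrC gtr0_norm//.
  move: (`|p - q| ^+ 2) (`|x - 2^-1 *: (p + q)| ^+ 2) pe qe => s t.
  move: (`|x - p| ^+ 2) (`|x - q| ^+ 2) => u v um vm par mt.
  suff : s <= 2 * (m + e + (m + e)) - 4 * m.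
    by rewrite (_ : _ - _ = 4 * e)//; ring.
  rewrite -[s](addrK (2 ^+ 2 * t)) par lerB//.
    by rewrite ler_wpM2l// lerD// ltW.
  by rewrite -natrX ler_wpM2l.
have FF : ProperFilter F.
  apply: filter_from_proper.
    apply: filter_from_filter; first by exists 1; exact: ltr01.
    move=> e f /= e0 f0.
    have [ef|fe] := real_leP (gtr0_real e0) (gtr0_real f0).
      exists e => // p [Pp pe]; do 2!split => //.
      by rewrite (lt_le_trans pe)// lerD2l.
    exists f => // p [Pp pf]; do 2!split => //.
    by rewrite (lt_le_trans pf)// lerD2l ltW.
  by move=> e /mlt[_ [p Pp <-] pe]; exists p.
have /cauchy_cvg /cvg_ex[y Fy] : cauchy F.
  apply: cauchy_exP => e e0.
  (* With this excess, [A_close] bounds the squared distance by e^2/2, which is below e^2. *)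
  have d0 : 0 < e ^+ 2 / 8 by rewrite divr_gt0// exprn_gt0.
  have [_ [p Pp <-] pe] := mlt _ d0; exists p.
  exists (e ^+ 2 / 8) => // q Aq.
  rewrite -ball_normE /ball_ /= -(@ltr_pXn2r _ 2) ?nnegrE ?(ltW e0)//.
  apply: le_lt_trans (A_close _ _ _ (conj Pp pe) Aq) _.
  rewrite (_ : 4 * _ = e ^+ 2 / 2); last by field.
  by rewrite ltr_pdivrMr// ltr_pMr ?exprn_gt0// ltr1n.
have near_y e d : 0 < e -> 0 < d -> exists2 p, A e p & `|y - p| < d.
  move=> e0 d0; have Fb : F (ball y d) by apply: Fy; exact: nbhsx_ballx.
  have FA : F (A e) by exists e.
  have [p [Ap yp]] := filter_ex (filterI FA Fb); exists p => //.
  by move: yp; rewrite -ball_normE.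
exists y.
  apply: cP => B /nbhs_ballP[d /= d0 dB].
  have [p [Pp _] yp] := near_y 1 d ltr01 d0; exists p; split => //.
  by apply: dB; rewrite -ball_normE.
move=> z Pz; have [->|z0] := eqVneq z 0; first exact: inner0r.
have nz : 0 < `|z| by rewrite normr_gt0.
apply/eqP; rewrite -normr_le0; apply/ler_addgt0Pr => c c0; rewrite add0r.
have c2 : 0 < c / 2 by rewrite divr_gt0.
have [p [Pp pe] yp] := near_y ((c / 2 / `|z|) ^+ 2) (c / 2 / `|z|)
  (exprn_gt0 2 (divr_gt0 c2 nz)) (divr_gt0 c2 nz).
rewrite -(subrK p x) -addrA innerDl.
apply: le_trans (ler_normD _ _) _; rewrite [leRHS]splitr lerD//; last first.
  apply: le_trans (cauchy_schwarz _ _) _; rewrite distrC -ler_pdivlMr//.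
  exact: ltW.
rewrite -(@ler_pXn2r _ 2) ?nnegrE ?(ltW c2)//.
(* Moving p to p + tz inside P cannot bring the squared distance below m, so the amount gained is at
   most the excess of p over m. *)
have := inner_decomp (x - p) z z0 => /=; set t := inner _ _ / _ => dec.
have /mle : [set `|x - p| ^+ 2 | p in P] (`|x - p - t *: z| ^+ 2).
  exists (p + t *: z); last by rewrite opprD addrA.
  exact: (subspaceD P _ _ sP Pp (subspaceZ P _ _ sP Pz)).
move=> mt; move: pe; rewrite dec => pe.
have : `|inner (x - p) z| ^+ 2 / `|z| ^+ 2 <= (c / 2 / `|z|) ^+ 2.
  rewrite -(lerD2l m) ltW// (le_lt_trans _ pe)// lerD2r//.
by rewrite [leRHS]exprMn exprVn ler_pM2r// invr_gt0 exprn_gt0.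
Qed.
End Projection.

Lemma ball_distP {K : numFieldType} {V : normedModType K} (x y : V) (e : K) :
  ball x e y <-> `|x - y| < e.
Proof. by rewrite -ball_normE. Qed.

Lemma closure_approx {K : numFieldType} {V : normedModType K} (A : set V) v :
  closure A v <-> forall e, 0 < e -> exists2 p, A p & `|v - p| < e.
Proof.
split=> [clA e e0|apx B /nbhs_ballP[e /= e0 eB]].
  have [p [Ap]] := clA _ (nbhsx_ballx v e e0); rewrite -ball_normE => vp.
  by exists p.
have [p Ap vp] := apx e e0; exists p; split => //; apply: eB.
by rewrite -ball_normE.
Qed.

Lemma bopB {R : realType} {V : normedModType R[i]} (f : bop V) (x y : V) :
  f (x - y) = f x - f y.
Proof.
by have [lf _] := bopP f; rewrite -scaleN1r addrC lf scaleN1r addrC.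
Qed.

Lemma bopD {R : realType} {V : normedModType R[i]} (f : bop V) (x y : V) :
  f (x + y) = f x + f y.
Proof. by have [lf _] := bopP f; have := lf 1 x y; rewrite !scale1r. Qed.

(** * Orthogonal projections and adjoints *)

Section OrthogonalProjection.
Context {R : realType} {H : hilbertType R}.
Implicit Types (x y z : H) (P L : set H).

Section Closed.
Context {P : set H} (clP : subspace_set P /\ closed P).

Lemma oprojP x : P (oproj P x) /\ forall z, P z -> inner (x - oproj P x) z = 0.
Proof.
have [sP cP] := clP; have [y Py xy] := projection_theorem P x sP cP.
by rewrite /oproj; case: xgetP => [_ -> []//|/(_ y)[]].
Qed.

Lemma oproj_in x : P (oproj P x).
Proof. by have [] := oprojP x. Qed.

Lemma oproj_perp_orth x z : P z -> inner (oproj_perp P x) z = 0.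
Proof. by have [_] := oprojP x; apply. Qed.

Lemma oproj_unique x y : P y -> (forall z, P z -> inner (x - y) z = 0) ->
  oproj P x = y.
Proof.
move=> Py xy; apply/eqP; rewrite -subr_eq0; apply/eqP/inner_eq0.
have Pd : P (oproj P x - y) by apply: subspaceB => //; [case: clP|exact: oproj_in].
rewrite -{1}(subrK x (oproj P x)) -addrA innerDl xy// addr0 -opprB.
by rewrite innerNl (oprojP x).2// oppr0.
Qed.

Lemma oproj_id x : P x -> oproj P x = x.
Proof. by move=> Px; apply: oproj_unique => // z _; rewrite subrr inner0l. Qed.

Lemma oproj_linear (k : R[i]) x y :
  oproj P (k *: x + y) = k *: oproj P x + oproj P y.
Proof.
have [[_ PD] _] := clP; apply: oproj_unique; first by apply: PD; exact: oproj_in.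
move=> z Pz; rewrite opprD addrACA -scalerBr innerDl innerZl.
by rewrite (oprojP x).2// (oprojP y).2// mulr0 addr0.
Qed.

Lemma oproj_perp_linear (k : R[i]) x y :
  oproj_perp P (k *: x + y) = k *: oproj_perp P x + oproj_perp P y.
Proof. by rewrite /oproj_perp oproj_linear opprD addrACA scalerBr. Qed.

Lemma oprojB x y : oproj P (x - y) = oproj P x - oproj P y.
Proof. by rewrite addrC -scaleN1r oproj_linear scaleN1r addrC. Qed.

Lemma oproj_perpB x y : oproj_perp P (x - y) = oproj_perp P x - oproj_perp P y.
Proof. by rewrite addrC -scaleN1r oproj_perp_linear scaleN1r addrC. Qed.

Lemma oproj_perpD x y : oproj_perp P (x + y) = oproj_perp P x + oproj_perp P y.
Proof. by rewrite -{1}(scale1r x) oproj_perp_linear scale1r. Qed.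

Lemma oproj_perp_eq0 x : oproj_perp P x = 0 <-> P x.
Proof.
split=> [/eqP|Px]; last by rewrite /oproj_perp oproj_id// subrr.
by rewrite subr_eq0 => /eqP ->; exact: oproj_in.
Qed.

(** The nearest-point property of the projection, from Pythagoras. It later compares the complements
    of nested subspaces. *)
Lemma norm_oproj_perp_le x y : P y -> `|oproj_perp P x| <= `|x - y|.
Proof.
move=> Py; rewrite -(@ler_pXn2r _ 2) ?nnegrE ?normr_ge0//.
have -> : x - y = oproj_perp P x + (oproj P x - y).
  by rewrite /oproj_perp addrA subrK.
have o : inner (oproj_perp P x) (oproj P x - y) = 0.
  apply: oproj_perp_orth; apply: subspaceB => //; first by case: clP.
  exact: oproj_in.
by rewrite (pythagoras _ _ o) lerDl exprn_ge0.
Qed.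

Lemma norm_oproj_perp x : `|oproj_perp P x| <= `|x|.
Proof.
rewrite -{2}(subr0 x); by apply: norm_oproj_perp_le; case: clP => -[].
Qed.

Lemma norm_oproj x : `|oproj P x| <= `|x|.
Proof.
rewrite -(@ler_pXn2r _ 2) ?nnegrE ?normr_ge0//.
rewrite -{2}(subrK (oproj P x) x).
rewrite (pythagoras _ _ ((oprojP x).2 _ (oproj_in x))) lerDr.
by rewrite exprn_ge0.
Qed.

End Closed.

(** Riesz representation of the functional x |-> <Tx, y>: w is a multiple of a vector u orthogonal
    to its kernel K. *)
Lemma bop_adjoint (T : bop H) y : exists w, forall x, inner (T x) y = inner x w.
Proof.
have [T0|] := pselect (forall x, inner (T x) y = 0).
  by exists 0 => x; rewrite T0 inner0r.
move=> /existsNP[v /eqP v0]; pose K := [set x | inner (T x) y = 0].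
have clK : subspace_set K /\ closed K.
  split.
    split; first by rewrite /K/= bop0 inner0l.
    move=> k x z Kx Kz; rewrite /K/= bopD bopZ innerDl innerZl.
    by rewrite Kx Kz mulr0 addr0.
  move=> x /closure_approx apx; apply/eqP; rewrite -normr_le0.
  apply/ler_addgt0Pr => e e0; rewrite add0r.
  have c0 : 0 < opnorm T * `|y| + 1 by rewrite ltr_wpDl ?mulr_ge0 ?opnorm_ge0.
  have [p Kp xp] := apx _ (divr_gt0 e0 c0).
  have -> : inner (T x) y = inner (T (x - p)) y by rewrite bopB innerBl Kp subr0.
  apply: le_trans (cauchy_schwarz _ _) _.
  apply: (@le_trans _ _ (opnorm T * `|y| * `|x - p|)).
    by rewrite mulrAC ler_wpM2r// le_opnorm.
  apply: (@le_trans _ _ ((opnorm T * `|y| + 1) * `|x - p|)).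
    by rewrite ler_wpM2r// lerDl.
  by rewrite mulrC -ler_pdivlMr// ltW.
pose u := oproj_perp K v; pose s := inner (T u) y.
have s0 : s != 0.
  rewrite /s /u /oproj_perp bopB innerBl [X in _ - X](oproj_in clK v) subr0.
  exact/eqP/eqP.
have uu0 : inner u u != 0.
  apply/eqP => /inner_eq0 u0; move: s0; rewrite /s u0 bop0 inner0l.
  by rewrite eqxx.
exists (Num.conj (s / inner u u) *: u) => x.
rewrite innerZr conjCK mulrAC -[LHS](mulfK uu0); congr (_ / _).
(* This combination is killed by the functional, hence orthogonal to u; expanding that orthogonality
   gives the formula. *)
have Kd : K (inner (T x) y *: u - s *: x).
  by rewrite /K/= bopB !bopZ innerBl !innerZl mulrC subrr.
have := oproj_perp_orth clK v _ Kd; rewrite -/u => /inner_eq0C.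
by rewrite innerBl !innerZl => /eqP; rewrite subr_eq0 => /eqP.
Qed.

End OrthogonalProjection.

(** * Total boundedness *)

Section TotallyBounded.
Context {I : Type} {K : numFieldType} {V : normedModType K}.

(** Colours replace finite nets, so no centres have to be chosen, and colourings can be pulled back,
    paired or collected into finite functions. *)
Definition tbounded (D : set I) (f : I -> V) : Prop :=
  forall e, 0 < e -> exists (T : finType) (c : I -> T),
    forall x y, D x -> D y -> c x = c y -> `|f x - f y| <= e.

Lemma precompact_tbounded (D : set I) (f : I -> V) :
  precompact (f @` D) -> tbounded D f.
Proof.
rewrite precompactE compact_cover => cD e e0.
have e2 : 0 < e / 2 by rewrite divr_gt0.
have [||S _ DS] := cD V setT (fun v => ball v (e / 2)).
- by move=> v _; exact: ball_open.
- by move=> v _; exists v => //; exact: ballxx.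
(* The colour of x is a ball of a finite subcover that contains f x; on D the value [None] never
   occurs. *)
exists (option S), (fun x => [pick v : S | `[< ball (val v) (e / 2) (f x) >]]).
have pickS x : D x -> exists2 v : S,
    [pick v : S | `[< ball (val v) (e / 2) (f x) >]] = Some v &
    ball (val v) (e / 2) (f x).
  move=> Dx; case: pickP => [v /asboolP|noS]; first by exists v.
  have [v vS fv] := DS (f x) (subset_closure (ex_intro2 _ _ x Dx erefl)).
  by have := noS [` vS]%fset; move/asboolP.
move=> x y /pickS[v -> vx] /pickS[w -> wy] [vw]; move: wy; rewrite -{}vw.
move: vx; rewrite -ball_normE /= => vx vy; rewrite (splitr e) -(subrKA (val v)).
by rewrite (le_trans (ler_normD _ _))// lerD// ltW// distrC.
Qed.

(** An ultrafilter on the closure of the image concentrates near a single colour class, for every e,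
    so it is Cauchy. Completeness is a hypothesis on filters because for [alg N] it is supplied by
    [alg_complete]. *)
Lemma tbounded_precompact (D : set I) (f : I -> V) :
  (forall F : set_system V, ProperFilter F -> cauchy F -> cvg F) ->
  tbounded D f -> precompact (f @` D).
Proof.
move=> complV tbD; rewrite precompactE compact_ultra => F UF FA.
have FF : ProperFilter F := @ultra_proper _ _ UF.
have /complV /cvg_ex[p Fp] : cauchy F.
  apply: cauchy_exP => e e0; have e4 : 0 < e / 4 by rewrite divr_gt0.
  have [T [c cP]] := tbD _ e4.
  (* These finitely many sets cover the closure of the image, so one of them belongs to F. *)
  pose S t := [set z | exists x, [/\ D x, c x = t & `|z - f x| < e / 4]].
  have [t FS] : exists t, F (S t).
    apply: contrapT => /forallNP noS.
    have FnS : \forall z \near F, forall t, ~ S t z.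
      apply: filter_forall => t.
      by have [/noS|] := in_ultra_setVsetC (S t) UF.
    have [z [/closure_approx zA zS]] := filter_ex (filterI FA FnS).
    have [_ [x Dx <-] zx] := zA _ e4.
    by apply: (zS (c x)); exists x.
  have [z [x [Dx cx zx]]] := filter_ex FS.
  exists z; apply: filterS FS => w [y [Dy cy wy]]; rewrite -ball_normE /=.
  have -> : z - w = z - f x + (f x - f y) + (f y - w).
    by rewrite !addrA !subrK.
  have -> : e = e / 4 + e / 4 + (e / 4 + e / 4) by field.
  rewrite (le_lt_trans (ler_normD _ _))// ltrD//.
    by rewrite (le_lt_trans (ler_normD _ _))// ltr_leD// cP// cx.
  by rewrite distrC (lt_trans wy)// ltrDl.
exists p; split => //; apply: closed_closure => B /Fp FB.
exact: filter_ex (filterI FA FB).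
Qed.

Lemma tbounded_sub (D E : set I) (f : I -> V) :
  E `<=` D -> tbounded D f -> tbounded E f.
Proof.
move=> ED tD e /tD[T [c cP]]; exists T, c => x y /ED Dx /ED Dy.
exact: cP.
Qed.

End TotallyBounded.

(** * Norm estimates and completeness of the nest algebra *)

Section NestAlgebraComplete.
Context {R : realType} {V : normedModType R[i]}.

Lemma bounded_linearP (f : V -> V) (M : R[i]) : 0 <= M -> linear f ->
  (forall x, `|f x| <= M * `|x|) -> f \in @bounded_linear R V.
Proof.
move=> M0 lf fM; apply/asboolP; split => // x.
have M1 : 0 < M + 1 by rewrite ltr_wpDl.
apply/cvgrPdist_lt => e e0.
apply/nbhs_ballP; exists (e / (M + 1)); first exact: divr_gt0.
move=> y; rewrite -ball_normE /= ltr_pdivlMr// => xy.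
have -> : f x - f y = f (x - y) by rewrite addrC -scaleN1r -lf scaleN1r addrC.
apply: le_lt_trans (fM _) _; apply: le_lt_trans xy.
by rewrite mulrC ler_wpM2l// lerDl.
Qed.

Lemma algB {N : nest V} (S T : alg N) v : (S - T) v = S v - T v.
Proof. by []. Qed.

Lemma le_algnorm {N : nest V} (T : alg N) v : `|T v| <= `|T| * `|v|.
Proof. exact: le_opnorm. Qed.

Lemma algnorm_le {N : nest V} (T : alg N) (M : R[i]) : 0 <= M ->
  (forall v, `|T v| <= M * `|v|) -> `|T| <= M.
Proof.
move=> M0 TM; apply: opnorm_le => v v1; apply: le_trans (TM v) _.
by rewrite ler_piMr.
Qed.

Lemma alg_invariant {N : nest V} (T : alg N) P v : N P -> P v -> P (T v).
Proof. by case: T => T /= /asboolP TN NP Pv; apply: (TN P NP); exists v. Qed.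
End NestAlgebraComplete.

Section Complete.
Context {R : realType} {H : completeNormedModType R[i]} {N : nest H}.

(** The limit is taken pointwise. Closedness of the nest elements keeps them invariant, and [Lnear],
    being uniform in v up to the factor |v|, upgrades pointwise to norm convergence. *)
Lemma alg_complete (F : set_system (alg N)) :
  ProperFilter F -> cauchy F -> cvg F.
Proof.
move=> FF cF.
have ballF e : 0 < e -> exists T0 : alg N, F (ball T0 e).
  by move=> e0; have /cauchyP := cF; apply.
have cvgF v : cvg ((fun T : alg N => T v) @ F).
  apply: cauchy_cvg; apply: cauchy_exP => e e0.
  have v1 : 0 < `|v| + 1 by rewrite ltr_wpDl.
  have [T0 FT0] := ballF _ (divr_gt0 e0 v1); exists (T0 v).
  suff: F [set T : alg N | ball (T0 v) e (T v)] by [].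
  apply: filterS FT0 => T /ball_distP; rewrite ltr_pdivlMr// => TT.
  apply/ball_distP.
  rewrite -algB; apply: le_lt_trans (le_algnorm _ _) _; apply: le_lt_trans TT.
  by rewrite ler_wpM2l// lerDl.
pose L v := lim ((fun T : alg N => T v) @ F).
have LF v : (fun T : alg N => T v) @ F --> L v by exact: cvgF.
have Lapx v d : 0 < d -> F [set T : alg N | `|L v - T v| < d].
  move=> d0; have Fb : F [set T : alg N | ball (L v) d (T v)].
    exact: (LF v _ (nbhsx_ballx (L v) d d0)).
  by apply: filterS Fb => T /ball_distP.
have L_lin : linear L.
  move=> k x y; have h := LF (k *: x + y).
  have h' : (fun T : alg N => T (k *: x + y)) @ F --> k *: L x + L y.
    rewrite (_ : (fun T : alg N => T (k *: x + y)) =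
                 (fun T : alg N => k *: T x + T y)).
      by apply: cvgD; [apply: cvgZl_tmp; exact: LF|exact: LF].
    by apply/funext => T; rewrite bopD bopZ.
  exact: (cvg_unique (@norm_hausdorff _ _) h h').
have LP P v : N P -> P v -> P (L v).
  move=> NP Pv; have [_] := nest_subspace (nestP N) NP; apply.
  apply/closure_approx => e e0.
  have [T LT] := filter_ex (Lapx v e e0).
  by exists (T v) => //; exact: alg_invariant.
have Lnear (T0 : alg N) e v : F (ball T0 e) -> `|L v - T0 v| <= e * `|v|.
  move=> FT0; apply/ler_addgt0Pr => d d0.
  have [T [T0T LT]] := filter_ex (filterI FT0 (Lapx v d d0)).
  rewrite -(subrKA (T v)) (le_trans (ler_normD _ _))//.
  rewrite [leRHS]addrC (lerD (ltW LT))//.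
  rewrite distrC -algB (le_trans (le_algnorm _ _))// ler_wpM2r//.
  by apply/ltW; move/ball_distP: T0T.
have [T1 FT1] := ballF 1 ltr01.
have L_bd v : `|L v| <= (1 + `|T1|) * `|v|.
  rewrite -(subrK (T1 v) (L v)) (le_trans (ler_normD _ _))// mulrDl lerD//.
    exact: Lnear.
  exact: le_algnorm.
have M0 : 0 <= 1 + `|T1| by rewrite addr_ge0.
pose Lb := Bop (bounded_linearP _ _ M0 L_lin L_bd).
have Lb_inv : Lb \in nest_invariant N.
  by apply/asboolP => P NP _ [v Pv <-]; exact: LP.
apply/cvg_ex; exists (Alg Lb_inv); apply/cvg_ballP => e e0.
have e4 : 0 < e / 4 by rewrite divr_gt0.
have [T0 FT0] := ballF _ e4; apply: filterS (FT0) => T T0T.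
apply/ball_distP; rewrite -(subrKA T0) (le_lt_trans (ler_normD _ _))//.
apply: (@lt_trans _ _ (e / 4 + e / 4)); last first.
  rewrite (_ : e / 4 + _ = e / 2); last by field.
  by rewrite ltr_pdivrMr// ltr_pMr// ltr1n.
apply: ler_ltD; last by move/ball_distP: T0T.
by apply: algnorm_le => [|v]; [exact: ltW|rewrite algB; exact: Lnear].
Qed.
End Complete.

(** * Compact multiplication operators *)

Section TotallyBoundedMaps.
Context {K : numFieldType} {V W : normedModType K}.

(** A colouring for g pulls back along h when f varies at most C times as much as g does along h. *)
Lemma tbounded_lip {I J : Type} (h : J -> I) (C : K) (D : set I) (E : set J)
    (g : I -> V) (f : J -> W) : 0 <= C -> (forall x, E x -> D (h x)) ->
  (forall x y, E x -> E y -> `|f x - f y| <= C * `|g (h x) - g (h y)|) ->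
  tbounded D g -> tbounded E f.
Proof.
move=> C0 ED fg tg e e0.
have C1 : 0 < C + 1 by rewrite ltr_wpDl.
have [T [c cP]] := tg _ (divr_gt0 e0 C1).
exists T, (c \o h) => x y Ex Ey cxy; apply: le_trans (fg _ _ Ex Ey) _.
have := cP _ _ (ED _ Ex) (ED _ Ey) cxy; rewrite ler_pdivlMr//; apply: le_trans.
by rewrite mulrC ler_wpM2l// lerDl.
Qed.

End TotallyBoundedMaps.

(** * Total boundedness of complex discs *)

Section Scalars.
Context {R : realType}.

(** A compact real interval is coloured once, and z receives the colours of its real and imaginary
    parts, each controlled up to e/2. *)
Lemma disc_coloring (M e : R[i]) : 0 < e -> exists (T : finType) (c : R[i] -> T),
  forall z w, `|z| <= M -> `|w| <= M -> c z = c w -> `|z - w| <= e.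
Proof.
move=> e0; have re0 : 0 < complex.Re e / 2.
  by rewrite divr_gt0// -ltcR (ge0_ReK e (ltW e0)).
pose m := complex.Re M.
have [T [c cP]] : exists (T : finType) (c : R -> T), forall x y : R,
    `|x| <= m -> `|y| <= m -> c x = c y -> `|x - y| <= complex.Re e / 2.
  have cI : precompact ((id : R -> R^o) @` `[- m, m]).
    apply: compact_precompact; first exact: norm_hausdorff.
    by rewrite image_id; exact: segment_compact.
  have [T [c cP]] := precompact_tbounded _ _ cI _ re0.
  exists T, c => x y xm ym.
  by apply: (cP x y); rewrite /= in_itv /= -ler_norml.
exists (T * T)%type, (fun z => (c (complex.Re z), c (complex.Im z))).
move=> z w zM wM [cRe cIm].
have normIm (u : R[i]) : `|complex.Im u|%:C <= `|u|.
  have := normc_ge_Re (u * 'i%C); rewrite ReiNIm normrN => /le_trans; apply.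
  by rewrite normrM complexiE normCi mulr1.
have bd (u : R[i]) : `|u| <= M ->
    `|complex.Re u| <= m /\ `|complex.Im u| <= m.
  move=> uM; have M0 : 0 <= M by apply: le_trans uM.
  rewrite -!lecR /m (ge0_ReK M M0); split; apply: le_trans uM => //.
  exact: normc_ge_Re.
have [zR zI] := bd z zM; have [wR wI] := bd w wM.
have := cP _ _ zR wR cRe; have := cP _ _ zI wI cIm.
rewrite normc_def -(ge0_ReK e (ltW e0)) lecR !raddfB /=.
move: (complex.Re z - _) (complex.Im z - _) => x y.
set h := complex.Re e / 2; have -> : complex.Re e = h + h by rewrite -splitr.
move=> yh xh; have h0 : 0 <= h by exact: ltW.
rewrite -(ger0_norm (addr_ge0 h0 h0)) -sqrtr_sqr ler_wsqrtr//.
rewrite sqrrD [leRHS]addrAC ler_wpDr ?(mulrn_wge0 2 (mulr_ge0 h0 h0))//.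
by rewrite lerD// -real_normK ?num_real// ler_sqr ?nnegrE.
Qed.
End Scalars.

(** * Rank-one operators, compact corners and the compactness of M_{a,b} *)

Section RankOne.
Context {R : realType} {H : hilbertType R} {N : nest H}.
Implicit Types (P L : set H) (f v w : H) (a b T : alg N).

Lemma nest_cl {P} : N P -> subspace_set P /\ closed P.
Proof. exact: (nest_subspace (nestP N)). Qed.

(* The chain condition [P' < P -> P' <= L] says that [P_-] is contained in [L];
   this is the form in which it makes [w] ⊗ [f] an element of the nest algebra
   when [w] is in [P] and [f] is orthogonal to [L]. *)
Definition pred_le P L :=
  [/\ N P, N L & forall P', N P' -> P' `<` P -> P' `<=` L].

(** Chosen with a default so that the term carries no proof; [rank1E] shows that the default is
    avoided under [pred_le]. *)
Definition rank1 w f : alg N :=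
  xget 0 [set T : alg N | forall v, T v = inner v f *: w].

(** Each P' in the nest is invariant: either it contains P, hence w, or it lies strictly below P,
    hence inside L, where f vanishes. *)
Lemma rank1E P L w f : pred_le P L -> P w -> (forall z, L z -> inner z f = 0) ->
  forall v, rank1 w f v = inner v f *: w.
Proof.
move=> [NP NL PL] Pw Lf; rewrite /rank1; case: xgetP => [T -> //|noT].
pose t v := inner v f *: w.
have t_lin : linear t.
  by move=> k x y; rewrite /t innerDl innerZl scalerDl scalerA.
have t_bd x : `|t x| <= `|f| * `|w| * `|x|.
  rewrite /t normrZ mulrAC ler_wpM2r// mulrC; exact: cauchy_schwarz.
have t0 : 0 <= `|f| * `|w| by rewrite mulr_ge0.
pose tb := Bop (bounded_linearP _ _ t0 t_lin t_bd).
have tb_inv : tb \in nest_invariant N.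
  apply/asboolP => P' NP' _ [v P'v <-]; rewrite [tb v]/(t v).
  have [sP' _] := nest_cl NP'.
  have [PP'|P'P] := nest_total (nestP N) NP NP'.
    by apply: subspaceZ => //; exact: PP'.
  have [PP'|PP'] := pselect (P `<=` P').
    by apply: subspaceZ => //; exact: PP'.
  have P'L := PL P' NP' (conj P'P PP').
  by rewrite /t Lf ?scale0r//; [case: sP'|exact: P'L].
by have := noT (Alg tb_inv); case.
Qed.

Lemma norm_rank1 P L w f : pred_le P L -> P w ->
  (forall z, L z -> inner z f = 0) -> `|rank1 w f| <= `|f| * `|w|.
Proof.
move=> PL Pw Lf; apply: algnorm_le => [|v]; first by rewrite mulr_ge0.
rewrite (rank1E _ _ _ _ PL Pw Lf) normrZ mulrAC ler_wpM2r// mulrC.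
exact: cauchy_schwarz.
Qed.

Lemma mulopE a b T v : mulop a b T v = a (T (b v)).
Proof. by []. Qed.

Definition restr_ball P : set H := [set w | P w /\ `|w| <= 1].

(** With g = f/|f|, evaluating M_{a,b}(w ⊗ g) at v0 gives <b v0, g> a w. So a is recovered on P with
    Lipschitz constant |v0|/|<b v0, g>|. *)
Lemma tbounded_left a b P L f v0 : pred_le P L ->
  (forall z, L z -> inner z f = 0) -> inner (b v0) f != 0 ->
  tbounded (@unit_ball _ (alg N)) (mulop a b) -> tbounded (restr_ball P) a.
Proof.
move=> PL Lf bf; have f0 : f != 0 by apply: contraNneq bf => ->; rewrite inner0r.
pose g := (`|f|^-1) *: f.
have Lg z : L z -> inner z g = 0.
  by move=> /Lf; rewrite innerZr => ->; rewrite mulr0.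
have g1 : `|g| = 1 by rewrite normrZ normfV normr_id mulVf// normr_eq0.
have bg : 0 < `|inner (b v0) g|.
  rewrite normr_gt0 innerZr mulf_neq0// fmorph_eq0 invr_eq0.
  by rewrite normr_eq0.
apply: (@tbounded_lip _ _ _ _ _ (fun w => rank1 w g) (`|v0| / `|inner (b v0) g|)).
- by rewrite divr_ge0.
- move=> w [Pw w1]; apply: le_trans (norm_rank1 _ _ _ _ PL Pw Lg) _.
  by rewrite g1 mul1r.
move=> w w' [Pw _] [Pw' _]; rewrite mulrAC ler_pdivlMr//.
rewrite mulrC -normrZ scalerBr -!bopZ [leRHS]mulrC.
rewrite -(rank1E _ _ _ _ PL Pw Lg) -(rank1E _ _ _ _ PL Pw' Lg) -!mulopE -algB.
exact: le_algnorm.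
Qed.

(** Schauder's argument: the functionals f orthogonal to L are coloured through u ⊗ f, one
    representative per colour is kept, and v is coloured by the values of b v at the
    representatives. *)
Lemma tbounded_right a b P L e : pred_le P L -> P e -> a e != 0 ->
  tbounded (@unit_ball _ (alg N)) (mulop a b) ->
  tbounded (@unit_ball _ H) (fun v => oproj_perp L (b v)).
Proof.
move=> PL Pe ae0 tM; have [NP NL _] := PL; have clL := nest_cl NL.
have e0 : e != 0 by apply: contraNneq ae0 => ->; rewrite bop0.
have [u [Pu u1 au]] : exists u, [/\ P u, `|u| = 1 & 0 < `|a u|].
  exists (`|e|^-1 *: e); split.
  - by apply: subspaceZ => //; case: (nest_cl NP).
  - by rewrite normrZ normfV normr_id mulVf// normr_eq0.
  by rewrite normr_gt0 bopZ scaler_eq0 negb_or ae0 andbT invr_eq0 normr_eq0.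
pose D : set H := [set f | (forall z, L z -> inner z f = 0) /\ `|f| <= 1].
have D0 : D 0 by split=> [z _|]; rewrite ?inner0r ?normr0.
move=> d d0; have d4 : 0 < d / 4 by rewrite divr_gt0.
have [T [c cP]] := tM _ (mulr_gt0 au d4).
pose cf f := c (rank1 u f).
(* For a colour that does not occur the default 0 is returned, which still lies in D. *)
pose r t : H := xget 0 [set f | D f /\ cf f = t].
have rD t : D (r t) by rewrite /r; case: xgetP => [f _ []|].
have rc f : D f -> cf (r (cf f)) = cf f.
  by move=> Df; rewrite /r; case: xgetP => [g _ []//|/(_ f)[]].
(* The factor |a u| cancels: functionals of equal colour nearly agree on the range of b. *)
have cfP f g v : D f -> D g -> cf f = cf g ->
    `|inner (b v) (f - g)| <= d / 4 * `|v|.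
  move=> [Lf f1] [Lg g1] cfg; rewrite -(ler_pM2l au) mulrA.
  apply: le_trans (ler_wpM2r (normr_ge0 v) (cP _ _ _ _ cfg)); last 2 first.
  - by apply: le_trans (norm_rank1 _ _ _ _ PL Pu Lf) _; rewrite u1 mulr1.
  - by apply: le_trans (norm_rank1 _ _ _ _ PL Pu Lg) _; rewrite u1 mulr1.
  apply: le_trans (le_algnorm _ _); rewrite algB !mulopE.
  rewrite (rank1E _ _ _ _ PL Pu Lf) (rank1E _ _ _ _ PL Pu Lg) !bopZ -scalerBl.
  by rewrite normrZ mulrC innerBr.
have d2 : 0 < d / 2 by rewrite divr_gt0.
have [T' [c' cP']] := disc_coloring `|b| _ d2.
exists {ffun T -> T'}, (fun v => [ffun t => c' (inner (b v) (r t))]).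
move=> v w v1 w1 /ffunP cvw; rewrite -oproj_perpB// -bopB.
set p := oproj_perp L _; have [->|p0] := eqVneq p 0; first by rewrite normr0 ltW.
pose f := (`|p|^-1) *: p.
have Df : D f.
  split=> [z Lz|]; last by rewrite normrZ normfV normr_id mulVf// normr_eq0.
  by rewrite innerZr (inner_eq0C _ _ (oproj_perp_orth clL _ _ Lz)) mulr0.
(* The norm of p is attained at its own direction f. Replacing f by its representative costs d/4 at
   v and at w, and the disc colouring costs d/2. *)
have -> : `|p| = `|inner (b (v - w)) f|.
  rewrite -(subrK (oproj L (b (v - w))) (b (v - w))) innerDl.
  rewrite [X in _ + X]Df.1 ?addr0; last exact: oproj_in.
  rewrite innerZr -inner_norm normrM normrX normr_id norm_conjC normfV normr_id.
  by rewrite expr2 mulKf// normr_eq0.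
have := cvw (cf f); rewrite !ffunE => /cP'.
set g := r (cf f).
have Dg : D g by exact: rD.
have bg x : `|x| <= 1 -> `|inner (b x) g| <= `|b|.
  move=> x1; apply: le_trans (cauchy_schwarz _ _) _.
  apply: le_trans (ler_piMr _ Dg.2) _ => //.
  by apply: le_trans (le_algnorm _ _) _; rewrite ler_piMr.
move=> /(_ (bg _ v1) (bg _ w1)) bvw.
rewrite -(subrK g f) innerDr (le_trans (ler_normD _ _))// [leRHS]splitr lerD//.
  rewrite bopB innerBl (le_trans (ler_normB _ _))//.
  rewrite (_ : d / 2 = d / 4 + d / 4); last by field.
  have cfg : cf f = cf g by rewrite [RHS]rc.
  by rewrite lerD// (le_trans (cfP _ _ _ Df Dg cfg))// ler_piMr// ltW.
by rewrite bopB innerBl.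
Qed.

Lemma compact_corner_left a P : N P ->
  compact_op (corner (oproj P) a) <-> tbounded (restr_ball P) a.
Proof.
move=> NP; have clP := nest_cl NP.
have cE v : corner (oproj P) a v = a (oproj P v).
  by rewrite /corner /= oproj_id//; exact: alg_invariant NP (oproj_in clP v).
split=> [/precompact_tbounded|] ta; last apply: tbounded_precompact => //.
- apply: (@tbounded_lip _ _ _ _ _ id 1) ta => // [x [] //|x y [Px _] [Py _]].
  by rewrite mul1r !cE !oproj_id.
- move=> F FF; exact: cauchy_cvg.
apply: (@tbounded_lip _ _ _ _ _ (oproj P) 1) ta => // [x x1|x y _ _].
  split; first exact: oproj_in.
  by apply: le_trans (norm_oproj clP x) _.
by rewrite mul1r !cE.
Qed.

Lemma compact_corner_right b L : N L ->
  compact_op (corner (oproj_perp L) b) <->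
  tbounded (@unit_ball _ H) (fun v => oproj_perp L (b v)).
Proof.
move=> NL; have clL := nest_cl NL.
have cE : corner (oproj_perp L) b = (fun v => oproj_perp L (b v)).
  apply/funext => v; rewrite /corner /= {2}/oproj_perp bopB oproj_perpB//.
  rewrite [X in _ - X](oproj_perp_eq0 clL _).2 ?subr0//.
  exact: alg_invariant NL (oproj_in clL v).
rewrite /compact_op cE; split; first exact: precompact_tbounded.
by apply: tbounded_precompact => F FF; exact: cauchy_cvg.
Qed.

Lemma compact_mulop a b :
  compact_op (mulop a b) <-> tbounded (@unit_ball _ (alg N)) (mulop a b).
Proof.
split; first exact: precompact_tbounded.
by apply: tbounded_precompact => F FF; exact: alg_complete.
Qed.

(** With Q^perp b small and a small on P, axb is close to (aQ) x (P^perp b). The error is a Q^perp x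
    b + a Q x P b, where Q^perp x b = Q^perp x Q^perp b by invariance of Q. The main term is
    coloured by the two total boundedness assumptions. *)
Lemma mulop_tbounded a b :
  (forall e, 0 < e -> exists P, [/\ N P, forall w, P w -> `|a w| <= e * `|w| &
     tbounded (@unit_ball _ H) (fun v => oproj_perp P (b v))]) ->
  (forall e, 0 < e -> exists P, [/\ N P,
     forall v, `|v| <= 1 -> `|oproj_perp P (b v)| <= e &
     tbounded (restr_ball P) a]) ->
  tbounded (@unit_ball _ (alg N)) (mulop a b).
Proof.
move=> low high e e0.
(* The errors add up to C d: |a| + |b| twice from [approx], |a| twice from [normg], and |b| + 1 from
   [gw]. *)
pose C := 4 * `|a| + 3 * `|b| + 1.
have C0 : 0 < C by rewrite ltr_wpDl// addr_ge0// mulr_ge0.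
pose d := e / C; have d0 : 0 < d by rewrite divr_gt0.
have [P [NP aP tB]] := low _ d0; have [Q [NQ bQ tA]] := high _ d0.
have clP := nest_cl NP; have clQ := nest_cl NQ.
pose B v := oproj_perp P (b v).
have normB v : `|v| <= 1 -> `|B v| <= `|b|.
  move=> v1; apply: le_trans (norm_oproj_perp clP _) _.
  by apply: le_trans (le_algnorm _ _) _; rewrite ler_piMr.
have normT (x : alg N) v : `|x| <= 1 -> `|x v| <= `|v|.
  by move=> x1; apply: le_trans (le_algnorm _ _) _; rewrite ler_piMl.
pose g (x : alg N) v := a (oproj Q (x (B v))).
have approx (x : alg N) v : `|x| <= 1 -> `|v| <= 1 ->
    `|mulop a b x v - g x v| <= d * (`|a| + `|b|).
  move=> x1 v1; rewrite mulopE.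
  have -> : a (x (b v)) - g x v =
      a (oproj_perp Q (x (b v))) + a (oproj Q (x (oproj P (b v)))).
    rewrite /g -bopB -bopD; congr (a _).
    rewrite /B /oproj_perp bopB oprojB// opprB.
    by rewrite addrA addrAC.
  rewrite (le_trans (ler_normD _ _))// mulrDr lerD//.
    apply: le_trans (le_algnorm _ _) _; rewrite mulrC ler_wpM2r//.
    rewrite -(subrK (oproj Q (b v)) (b v)) bopD oproj_perpD//.
    rewrite [X in _ + X](oproj_perp_eq0 clQ _).2 ?addr0; last first.
      exact: alg_invariant NQ (oproj_in clQ _).
    apply: le_trans (norm_oproj_perp clQ _) _.
    by apply: le_trans (normT _ _ x1) _; exact: bQ.
  set w := x (oproj P (b v)).
  have Pw : P w by exact: alg_invariant NP (oproj_in clP _).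
  (* P and Q may be nested either way: if P is the smaller, Q fixes w; if Q is, its range lies in
     P. *)
  have PQw : P (oproj Q w).
    have [PQ|QP] := nest_total (nestP N) NP NQ; last exact: QP (oproj_in clQ w).
    by rewrite oproj_id//; exact: PQ.
  apply: le_trans (aP _ PQw) _; rewrite (ler_wpM2l (ltW d0))//.
  apply: le_trans (norm_oproj clQ _) _; apply: le_trans (normT _ _ x1) _.
  apply: le_trans (norm_oproj clP _) _.
  by apply: le_trans (le_algnorm _ _) _; rewrite ler_piMr.
have normg (x : alg N) v w : `|x| <= 1 -> `|B v - B w| <= d ->
    `|g x v - g x w| <= d * `|a|.
  move=> x1 vw; rewrite /g -bopB -oprojB// -bopB.
  apply: le_trans (le_algnorm _ _) _; rewrite mulrC ler_wpM2r//.
  by apply: le_trans (norm_oproj clQ _) _; apply: le_trans (normT _ _ x1) _.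
have [T [c cP]] := tB _ d0; have [T' [c' cP']] := tA _ d0.
pose r t : H := xget 0 [set v | `|v| <= 1 /\ c v = t].
have r1 t : `|r t| <= 1 by rewrite /r; case: xgetP => [f _ []|]; rewrite ?normr0.
have rc v : `|v| <= 1 -> c (r (c v)) = c v.
  by move=> v1; rewrite /r; case: xgetP => [w _ []//|/(_ v)[]].
have b1 : 0 < `|b| + 1 by rewrite ltr_wpDl.
(* The scaling brings the vector into the unit ball of Q, where the colouring for a applies. *)
pose s (x : alg N) t := (`|b| + 1)^-1 *: oproj Q (x (B (r t))).
have s1 (x : alg N) t : `|x| <= 1 -> restr_ball Q (s x t).
  move=> x1; split; first by apply: subspaceZ (oproj_in clQ _); case: clQ.
  rewrite normrZ normfV gtr0_norm// ler_pdivrMl// mulr1.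
  apply: le_trans (norm_oproj clQ _) _; apply: le_trans (normT _ _ x1) _.
  by apply: le_trans (normB _ (r1 t)) _; rewrite lerDl.
exists {ffun T -> T'}, (fun x => [ffun t => c' (s x t)]) => x y x1 y1 /ffunP cxy.
apply: opnorm_le => v v1; rewrite [X in `|X|]algB.
pose w := r (c v).
have w1 : `|w| <= 1 by exact: r1.
have Bvw : `|B v - B w| <= d by apply: cP => //; rewrite [RHS]rc.
have gw : `|g x w - g y w| <= d * (`|b| + 1).
  have := cP' _ _ (s1 _ (c v) x1) (s1 _ (c v) y1).
  have := cxy (c v); rewrite !ffunE => -> /(_ erefl).
  rewrite -/w /s !bopZ -scalerBr normrZ normfV gtr0_norm//.
  by rewrite ler_pdivrMl// mulrC.
have -> : mulop a b x v - mulop a b y v =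
    (mulop a b x v - g x v) + ((g x v - g x w) + (g x w - g y w) +
    (g y w - g y v)) - (mulop a b y v - g y v).
  by rewrite opprB !addrA !subrK.
have -> : e = d * (`|a| + `|b|) + (d * `|a| + d * (`|b| + 1) + d * `|a|) +
    d * (`|a| + `|b|).
  rewrite -[LHS](divfK (lt0r_neq0 C0)) -/d /C; ring.
rewrite (le_trans (ler_normB _ _))// lerD ?approx//.
rewrite (le_trans (ler_normD _ _))// lerD ?approx//.
rewrite (le_trans (ler_normD _ _))// lerD//; last by rewrite normg// distrC.
by rewrite (le_trans (ler_normD _ _))// lerD ?normg.
Qed.

End RankOne.

(** * Order in the nest *)

Section NestOrder.
Context {R : realType} {H : hilbertType R} {N : nest H}.
Implicit Types (P Q L : set H) (v w : H) (a b : alg N).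

Lemma nest_lt_not P Q : N P -> N Q -> ~ (P `<=` Q) -> Q `<` P.
Proof.
by move=> NP NQ PQ; split=> //; case: (nest_total (nestP N) NP NQ).
Qed.

Lemma sub_closed_span (A : set H) : A `<=` closed_span A.
Proof.
by move=> x Ax; apply: subset_closure => B [_]; apply.
Qed.

Lemma closed_span_min (A P : set H) : subspace_set P /\ closed P ->
  A `<=` P -> closed_span A `<=` P.
Proof.
move=> [sP cP] AP; rewrite /closed_span.
have AP' : smallest (@subspace_set R[i] H) A `<=` P by move=> x; apply.
by move=> x /(closure_subset AP'); exact: cP.
Qed.

Lemma nest_vee_ub (S : set (set H)) P : S P -> P `<=` nest_vee S.
Proof. by move=> SP x Px; apply: sub_closed_span; exists P. Qed.

Lemma nest_vee_lub (S : set (set H)) P : N P ->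
  (forall P', S P' -> P' `<=` P) -> nest_vee S `<=` P.
Proof.
move=> NP SP; apply: closed_span_min; first exact: (nest_cl (N := N)).
by move=> x [P' SP' P'x]; exact: SP P'x.
Qed.

Lemma nest_succ_nest P : N (nest_succ N P).
Proof. by apply: (nest_closed_wedge (nestP N)) => P' []. Qed.

Lemma nest_pred_nest P : N (nest_pred N P).
Proof. by apply: (nest_closed_vee (nestP N)) => P' []. Qed.

Lemma nest_succ_ge P : P `<=` nest_succ N P.
Proof. by move=> x Px P' [_ [PP' _]]; exact: PP'. Qed.

Lemma nest_succ_le P P' : N P' -> P `<` P' -> nest_succ N P `<=` P'.
Proof. by move=> NP' PP' x; apply. Qed.

Lemma nest_pred_ge P P' : N P' -> P' `<` P -> P' `<=` nest_pred N P.
Proof. by move=> NP' P'P; apply: nest_vee_ub. Qed.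

Lemma nest_pred_le P : N P -> nest_pred N P `<=` P.
Proof. by move=> NP; apply: nest_vee_lub => // P' [_ []]. Qed.

(** This pair produces the corner of b at P_-^perp; the pair (P_+, P) of the next lemma produces the
    corner of a at P_+. *)
Lemma pred_le_nest_pred P : N P -> pred_le (N := N) P (nest_pred N P).
Proof.
by move=> NP; split=> //; [exact: nest_pred_nest|exact: nest_pred_ge].
Qed.

Lemma pred_le_nest_succ P : N P -> pred_le (N := N) (nest_succ N P) P.
Proof.
move=> NP; split=> //; first exact: nest_succ_nest.
move=> P' NP' [_ sP']; apply: contrapT => /(nest_lt_not _ _ NP' NP).
by move=> /(nest_succ_le _ _ NP').
Qed.

Lemma ker_cl (T : bop H) : subspace_set [set x | T x = 0] /\
  closed [set x | T x = 0].
Proof.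
split.
  split; first exact: bop0.
  by move=> k x y /= Tx Ty; rewrite bopD bopZ Tx Ty scaler0 addr0.
move=> x /closure_approx apx; apply/eqP; rewrite -normr_le0.
apply/ler_addgt0Pr => e e0; rewrite add0r.
have c0 : 0 < opnorm T + 1 by rewrite ltr_wpDl ?opnorm_ge0.
have [p /= Tp xp] := apx _ (divr_gt0 e0 c0).
have -> : T x = T (x - p) by rewrite bopB Tp subr0.
apply: le_trans (le_opnorm _ _) _.
apply: (@le_trans _ _ ((opnorm T + 1) * `|x - p|)).
  by rewrite ler_wpM2r// lerDl.
by rewrite mulrC -ler_pdivlMr// ltW.
Qed.

Lemma Rspace_nest a : N (Rspace a).
Proof. by apply: (nest_closed_vee (nestP N)) => P []. Qed.

(** The kernel of a is a closed subspace, so the join defining R_a stays inside it. *)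
Lemma Rspace_ker a w : Rspace a w -> a w = 0.
Proof.
apply: (closed_span_min _ _ (ker_cl a)) => x [P [NP aP] Px] /=.
have /(congr1 (fun f => f x)) := aP.
by rewrite /= oproj_id//; exact: (nest_cl (N := N)).
Qed.

Lemma sub_Rspace a P : N P -> (forall w, P w -> a w = 0) -> P `<=` Rspace a.
Proof.
move=> NP aP; apply: nest_vee_ub; split=> //.
by apply/funext => x /=; apply: aP; apply: oproj_in; exact: (nest_cl (N := N)).
Qed.

Lemma Rspace_lt a P : N P -> Rspace a `<` P -> exists2 w, P w & a w != 0.
Proof.
move=> NP [_ PR]; apply: contrapT => noW; apply: PR; apply: sub_Rspace => // w Pw.
by apply/eqP/negPn/negP => aw; apply: noW; exists w.
Qed.

Lemma Qspace_nest b : N (Qspace b).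
Proof. by apply: (nest_closed_wedge (nestP N)) => P []. Qed.

Lemma Qspace_range b v : Qspace b (b v).
Proof.
move=> P [NP /(congr1 (fun f => f v)) /= Pb].
by apply/(oproj_perp_eq0 (nest_cl NP)).
Qed.

Lemma Qspace_sub b P : N P -> (forall v, P (b v)) -> Qspace b `<=` P.
Proof.
move=> NP Pb x; apply; split=> //; apply/funext => v /=.
by apply/(oproj_perp_eq0 (nest_cl NP)).
Qed.

(** Some b v lies outside P; f is its component orthogonal to P, and <b v, f> = |f|^2. *)
Lemma Qspace_gt b P : N P -> P `<` Qspace b -> exists v f,
  (forall z, P z -> inner z f = 0) /\ inner (b v) f != 0.
Proof.
move=> NP [_ QP]; have clP := nest_cl NP.
have [v Pv] : exists v, ~ P (b v).
  by apply/existsNP => Pb; apply: QP; exact: Qspace_sub.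
exists v, (oproj_perp P (b v)); split.
  by move=> z Pz; apply/inner_eq0C/oproj_perp_orth.
rewrite -{1}(subrK (oproj P (b v)) (b v)) innerDl.
rewrite [X in _ + X](inner_eq0C _ _ (oproj_perp_orth clP _ _ (oproj_in clP _))).
rewrite addr0; apply/eqP => /inner_eq0 p0; apply: Pv.
exact/(oproj_perp_eq0 clP).
Qed.

(** Otherwise b maps into R_a, which T preserves and a annihilates, so every aTb is 0. *)
Lemma Rspace_lt_Qspace a b : mulop a b <> cst 0 -> Rspace a `<` Qspace b.
Proof.
move=> M0; apply: nest_lt_not; [exact: Qspace_nest|exact: Rspace_nest|].
move=> QR; apply: M0; apply/funext => T; apply/val_inj/val_inj/funext => v.
have Rv : Rspace a (b v) by apply: QR; exact: Qspace_range.
exact: Rspace_ker (alg_invariant T _ _ (Rspace_nest a) Rv).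
Qed.

Lemma tbounded_perp_le b L L' : N L -> N L' -> L `<=` L' ->
  tbounded (@unit_ball _ H) (fun v => oproj_perp L (b v)) ->
  tbounded (@unit_ball _ H) (fun v => oproj_perp L' (b v)).
Proof.
move=> NL NL' LL'; have clL := nest_cl NL; have clL' := nest_cl NL'.
apply: (tbounded_lip id 1) => // v w _ _.
rewrite mul1r -!oproj_perpB//; apply: (norm_oproj_perp_le clL').
by apply: LL'; exact: oproj_in.
Qed.

Lemma tbounded_restr_le a P P' : P `<=` P' ->
  tbounded (restr_ball P') a -> tbounded (restr_ball P) a.
Proof. by move=> PP'; apply: tbounded_sub => w [/PP']. Qed.

(** In a chain the smallest of finitely many elements above P is still strictly above P; P0 serves
    as start, also for an empty family. *)
Lemma nest_finite_min (T : finType) (S : T -> set H) P0 P : N P0 -> P `<` P0 ->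
  (forall t, N (S t) /\ P `<` S t) ->
  exists Q, [/\ N Q, P `<` Q, Q `<=` P0 & forall t, Q `<=` S t].
Proof.
move=> NP0 PP0 NS.
suff [Q [NQ PQ QP0 QS]] : exists Q, [/\ N Q, P `<` Q, Q `<=` P0 &
    forall t, t \in enum T -> Q `<=` S t].
  by exists Q; split=> // t; apply: QS; rewrite mem_enum.
elim: (enum T) => [|t s [Q [NQ PQ QP0 QS]]]; first by exists P0; split.
have [NSt PSt] := NS t.
have [QSt|StQ] := nest_total (nestP N) NQ NSt.
  by exists Q; split=> // u; rewrite inE => /predU1P[->|/QS].
exists (S t); split=> //; first exact: subset_trans QP0.
by move=> u; rewrite inE => /predU1P[->//|/QS]; exact: subset_trans.
Qed.

Lemma nest_finite_max (T : finType) (S : T -> set H) P0 P : N P0 -> P0 `<` P ->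
  (forall t, N (S t) /\ S t `<` P) ->
  exists Q, [/\ N Q, Q `<` P, P0 `<=` Q & forall t, S t `<=` Q].
Proof.
move=> NP0 PP0 NS.
suff [Q [NQ PQ QP0 QS]] : exists Q, [/\ N Q, Q `<` P, P0 `<=` Q &
    forall t, t \in enum T -> S t `<=` Q].
  by exists Q; split=> // t; apply: QS; rewrite mem_enum.
elim: (enum T) => [|t s [Q [NQ PQ QP0 QS]]]; first by exists P0; split.
have [NSt PSt] := NS t.
have [StQ|QSt] := nest_total (nestP N) NSt NQ.
  by exists Q; split=> // u; rewrite inE => /predU1P[->|/QS].
exists (S t); split=> //; first exact: subset_trans QSt.
by move=> u; rewrite inE => /predU1P[->//|/QS/subset_trans]; apply.
Qed.

(** * Approximation at limit points of the nest *)

Lemma closure_subspace (P : set H) : subspace_set P ->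
  subspace_set (closure P) /\ closed (closure P).
Proof.
move=> sP; split; last exact: closed_closure.
split; first by apply: subset_closure; case: sP.
move=> k x y /closure_approx Px /closure_approx Py; apply/closure_approx => e e0.
have k0 : 0 < `|k| + 1 by rewrite ltr_wpDl.
have e2 : 0 < e / 2 by rewrite divr_gt0.
have [p Pp xp] := Px _ (divr_gt0 e2 k0); have [q Pq yq] := Py _ e2.
exists (k *: p + q); first by case: sP => _; apply.
rewrite opprD addrACA -scalerBr (le_lt_trans (ler_normD _ _))// [ltRHS]splitr.
apply: ler_ltD => //; rewrite normrZ.
apply: (@le_trans _ _ ((`|k| + 1) * `|x - p|)).
  by rewrite ler_wpM2r// lerDl.
by rewrite mulrC -ler_pdivlMr// ltW.
Qed.

(* A vector orthogonal to all P'^perp, P' > P, lies in every P', hence in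
   P = P_+; thus P^perp is the closure of the union of the P'^perp. *)
Lemma orth_succ_approx P P0 w : N P -> nest_succ N P `<=` P ->
  N P0 -> P `<` P0 -> (forall z, P z -> inner z w = 0) ->
  forall e, 0 < e -> exists P' p, [/\ N P', P `<` P',
    forall z, P' z -> inner z p = 0 & `|w - p| < e].
Proof.
move=> NP sP NP0 PP0 wP.
pose M0 := [set p | exists P',
  [/\ N P', P `<` P' & forall z, P' z -> inner z p = 0]].
have sM0 : subspace_set M0.
  split; first by exists P0; split=> // z _; rewrite inner0r.
  move=> k x y [P1 [N1 PP1 x1]] [P2 [N2 PP2 y2]].
  have [P12|P21] := nest_total (nestP N) N1 N2.
    exists P1; split=> // z P1z.
    rewrite innerDr innerZr x1// y2 ?mulr0 ?addr0//.
    exact: P12.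
  exists P2; split=> // z P2z; rewrite innerDr innerZr x1 ?y2 ?mulr0 ?addr0//.
  exact: P21.
have clM := closure_subspace _ sM0.
pose u := oproj_perp (closure M0) w.
have uP : P u.
  apply: sP => P' [NP' PP']; have clP' := nest_cl NP'.
  apply/(oproj_perp_eq0 clP')/inner_eq0.
  have := oproj_perp_orth clM w (oproj_perp P' u); rewrite -/u.
  rewrite -{2}(subrK (oproj P' u) u) innerDl.
  rewrite [X in _ + X](inner_eq0C _ _ (oproj_perp_orth clP' _ _ (oproj_in clP' _))).
  rewrite addr0; apply; apply: subset_closure; exists P'; split=> // z P'z.
  exact/inner_eq0C/oproj_perp_orth.
(* The vector u lies in P, hence is orthogonal to w, and it is orthogonal to w - u in the closure of
   [M0]; so it is orthogonal to itself. *)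
have u0 : u = 0.
  apply: inner_eq0; rewrite {1}/u /oproj_perp innerBl.
  rewrite (inner_eq0C _ _ (wP _ uP)).
  rewrite (inner_eq0C _ _ (oproj_perp_orth clM _ _ (oproj_in clM _))).
  by rewrite subrr.
have /closure_approx Mw : closure M0 w by apply/(oproj_perp_eq0 clM).
move=> e /Mw[p [P' [NP' PP' pP']] wp].
by exists P', p.
Qed.

(* [a w] is tested against the finitely many values of [a] that represent the
   colours; each of these functionals vanishes on P, so it is represented by a
   vector that is nearly orthogonal to some P' > P. *)
Lemma small_above a P P0 : N P -> nest_succ N P `<=` P ->
  (forall w, P w -> a w = 0) -> N P0 -> P `<` P0 -> tbounded (restr_ball P0) a ->
  forall e, 0 < e -> exists P', [/\ N P', P `<` P', P' `<=` P0 &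
    forall w, P' w -> `|a w| <= e * `|w|].
Proof.
move=> NP sP aP NP0 PP0 ta e e0.
have e2 : 0 < e / 2 by rewrite divr_gt0.
have ee : 0 < e / 2 * (e / 2) by rewrite mulr_gt0.
have [T [c cP]] := ta _ e2.
pose r t : H := xget 0 [set w | restr_ball P0 w /\ c w = t].
have [P00 _] := nest_cl NP0; have P00' : P0 0 by case: P00.
have rP t : restr_ball P0 (r t).
  rewrite /r; case: xgetP => [f _ []//|_]; split=> //; by rewrite normr0.
have rc w : restr_ball P0 w -> c (r (c w)) = c w.
  by move=> w1; rewrite /r; case: xgetP => [f _ []//|/(_ w)[]].
have /choice[S SP] t : exists Q, (N Q /\ P `<` Q) /\
    forall w, Q w -> `|w| <= 1 -> `|inner (a w) (a (r t))| <= e / 2 * (e / 2).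
  have [y yE] := bop_adjoint a (a (r t)).
  have yP z : P z -> inner z y = 0 by move=> Pz; rewrite -yE aP// inner0l.
  have [Q [p [NQ PQ pQ yp]]] := orth_succ_approx _ _ _ NP sP NP0 PP0 yP _ ee.
  exists Q; split=> // w Qw w1; rewrite yE -(subrK p y) innerDr pQ// addr0.
  apply: le_trans (cauchy_schwarz _ _) _; apply: le_trans (ltW yp).
  by rewrite ler_piMl.
have [Q [NQ PQ QP0 QS]] := nest_finite_min _ _ _ _ NP0 PP0 (fun t => (SP t).1).
exists Q; split=> //.
have ball1 w : Q w -> `|w| <= 1 -> `|a w| <= e.
  move=> Qw w1; have Dw : restr_ball P0 w by split=> //; exact: QP0.
  set y := a (r (c w)).
  have wy : `|a w - y| <= e / 2 by apply: cP => //; rewrite rc.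
  have iwy : `|inner (a w) y| <= e / 2 * (e / 2).
    by apply: (SP (c w)).2 => //; exact: QS.
  have aw2 : `|a w| * `|a w| <= `|a w| * (e / 2) + e / 2 * (e / 2).
    rewrite -expr2 inner_norm -[leLHS]ger0_norm; last first.
      by rewrite -inner_norm exprn_ge0.
    rewrite -{2}(subrK y (a w)) innerDr (le_trans (ler_normD _ _))// lerD//.
    by apply: le_trans (cauchy_schwarz _ _) _; rewrite ler_wpM2l.
  have [//|ew] := real_leP (ger0_real (normr_ge0 (a w))) (gtr0_real e0).
  (* If |a w| exceeded e, both factors would exceed or equal e/2 with enough room to contradict
     [aw2]. *)
  have : e / 2 * (e / 2) < `|a w| * (`|a w| - e / 2).
    rewrite ltr_pM// ?ltW//; last by rewrite ltrBrDr -splitr.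
    by apply: le_lt_trans ew; rewrite [leRHS]splitr lerDl ltW.
  by rewrite mulrBr ltrBrDr addrC => /lt_le_trans/(_ aw2); rewrite ltxx.
move=> w Qw; have [->|w0] := eqVneq w 0; first by rewrite bop0 !normr0 mulr0.
have nw : 0 < `|w| by rewrite normr_gt0.
rewrite -ler_pdivrMr// mulrC -{1}(normr_id w) -normfV -normrZ -bopZ.
apply: ball1; first by apply: subspaceZ => //; case: (nest_cl NQ).
by rewrite normrZ normfV normr_id mulVf// gt_eqF.
Qed.

(** The union of a nonempty chain of subspaces is a subspace, so the closed span is merely the
    closure of the union. *)
Lemma vee_approx P P0 v : N P0 -> P0 `<` P -> P v -> P `<=` nest_pred N P ->
  forall e, 0 < e -> exists P', (N P' /\ P' `<` P) /\ `|oproj_perp P' v| <= e.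
Proof.
move=> NP0 P0P Pv PP e e0.
pose U := \bigcup_(Q in [set Q | N Q /\ Q `<` P]) Q.
have sU : subspace_set U.
  split; first by exists P0 => //; case: (nest_cl NP0) => -[].
  move=> k x y [Q [NQ QP] Qx] [Q' [NQ' QP'] Qy].
  have [QQ'|Q'Q] := nest_total (nestP N) NQ NQ'.
    exists Q' => //; case: (nest_cl NQ') => -[_ h] _.
    by apply: h => //; exact: QQ'.
  exists Q => //; case: (nest_cl NQ) => -[_ h] _.
  by apply: h => //; exact: Q'Q.
have : closure U v.
  have UU : smallest (@subspace_set R[i] H) U `<=` U by move=> x; apply; split.
  exact: closure_subset UU _ (PP v Pv).
move=> /closure_approx/(_ e e0)[p [Q [NQ QP] Qp] vp].
exists Q; split=> //; apply: le_trans (ltW vp).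
exact: norm_oproj_perp_le (nest_cl NQ) _ _ Qp.
Qed.

(** Each of the finitely many representatives b(r t) is within e/2 of some element below Q_b; the
    largest of these elements and P0 works for all. Enlarging P0 keeps the colour estimate, since
    complements shrink. *)
Lemma small_below b P0 : N P0 -> P0 `<` Qspace b ->
  Qspace b `<=` nest_pred N (Qspace b) ->
  tbounded (@unit_ball _ H) (fun v => oproj_perp P0 (b v)) ->
  forall e, 0 < e -> exists P', [/\ N P', P0 `<=` P', P' `<` Qspace b &
    forall v, `|v| <= 1 -> `|oproj_perp P' (b v)| <= e].
Proof.
move=> NP0 P0Q Qpred tb e e0.
have e2 : 0 < e / 2 by rewrite divr_gt0.
have [T [c cP]] := tb _ e2.
pose r t : H := xget 0 [set w | `|w| <= 1 /\ c w = t].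
have r1 t : `|r t| <= 1 by rewrite /r; case: xgetP => [f _ []|]; rewrite ?normr0.
have rc w : `|w| <= 1 -> c (r (c w)) = c w.
  by move=> w1; rewrite /r; case: xgetP => [f _ []//|/(_ w)[]].
have /choice[S SP] t := vee_approx _ _ _ NP0 P0Q (Qspace_range b (r t)) Qpred _ e2.
have [Q [NQ QQ P0Q' SQ]] := nest_finite_max _ _ _ _ NP0 P0Q (fun t => (SP t).1).
exists Q; split=> // v v1; have clQ := nest_cl NQ; have clP0 := nest_cl NP0.
rewrite -(subrK (b (r (c v))) (b v)) oproj_perpD//.
rewrite (le_trans (ler_normD _ _))// [leRHS]splitr lerD//.
  set x := b v - _; have Qx : Q (oproj P0 x) by apply: P0Q'; exact: oproj_in.
  apply: le_trans (norm_oproj_perp_le clQ x _ Qx) _.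
  rewrite -/(oproj_perp P0 x) oproj_perpB//.
  by apply: cP => //; [exact: r1|rewrite rc].
apply: le_trans (SP (c v)).2.
have [[NS _] _] := SP (c v).
apply: norm_oproj_perp_le => //; apply: SQ; exact: oproj_in (nest_cl NS) _.
Qed.

Lemma nest_succ_pred P : N P -> P `<=` nest_succ N (nest_pred N P).
Proof.
move=> NP x Px P' [NP' [_ P'P]]; apply: contrapT => P'x; apply: P'P.
apply: nest_pred_ge => //; apply: nest_lt_not => // PP'.
by apply: P'x; exact: PP'.
Qed.

Lemma nest_pred_succ P : N P -> nest_pred N (nest_succ N P) `<=` P.
Proof.
move=> NP; have [_ _ sP] := pred_le_nest_succ _ NP.
by apply: nest_vee_lub => // P' [NP' P'P]; exact: sP.
Qed.

(** * From M_{a,b} to its corners and back *)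

Section Multiplication.
Context {a b : alg N}.
Hypothesis RaQb : Rspace a `<` Qspace b.

Lemma compact_mulop_left P L : pred_le (N := N) P L -> L `<` Qspace b ->
  compact_op (mulop a b) -> compact_op (corner (oproj P) a).
Proof.
move=> PL LQ /compact_mulop tM; have [NP NL _] := PL.
have [v [f [Lf bf]]] := Qspace_gt _ _ NL LQ.
by apply/compact_corner_left => //; exact: tbounded_left PL Lf bf tM.
Qed.

Lemma compact_mulop_right P L : pred_le (N := N) P L -> Rspace a `<` P ->
  compact_op (mulop a b) -> compact_op (corner (oproj_perp L) b).
Proof.
move=> PL RP /compact_mulop tM; have [NP NL _] := PL.
have [e Pe ae] := Rspace_lt _ _ NP RP.
by apply/compact_corner_right => //; exact: tbounded_right PL Pe ae tM.
Qed.

Definition compact_corners := forall P : set H,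
  N P -> Rspace a `<` P -> P `<` Qspace b ->
  compact_op (corner (oproj (nest_succ N P)) a) /\
  compact_op (corner (oproj_perp (nest_pred N P)) b).

Lemma corners_tbounded : compact_corners -> forall P, N P ->
  Rspace a `<` P -> P `<` Qspace b ->
  tbounded (restr_ball (nest_succ N P)) a /\
  tbounded (@unit_ball _ H) (fun v => oproj_perp (nest_pred N P) (b v)).
Proof.
move=> cor P NP RP PQ; have [/compact_corner_left ca /compact_corner_right cb] :=
  cor P NP RP PQ.
by split; [apply: ca; exact: nest_succ_nest|apply: cb; exact: nest_pred_nest].
Qed.

(** If R_a < R_a+, then P = R_a works: a vanishes there, and the corner at R_a+ < Q_b controls b
    because (R_a+)_- is contained in R_a. If R_a = R_a+, [small_above] supplies P > R_a. *)
Lemma corners_low : nest_succ N (Rspace a) <> Qspace b -> compact_corners ->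
  forall e, 0 < e -> exists P, [/\ N P, forall w, P w -> `|a w| <= e * `|w| &
    tbounded (@unit_ball _ H) (fun v => oproj_perp P (b v))].
Proof.
move=> sRQ /corners_tbounded cor e e0.
have NRa := Rspace_nest a; have NQb := Qspace_nest b.
have NsR := nest_succ_nest (Rspace a).
have [sRR|sRR] := pselect (nest_succ N (Rspace a) `<=` Rspace a); last first.
  have RsR : Rspace a `<` nest_succ N (Rspace a) by split=> //; exact: nest_succ_ge.
  have sRQb : nest_succ N (Rspace a) `<` Qspace b.
    have sQ : nest_succ N (Rspace a) `<=` Qspace b.
      exact: nest_succ_le (Qspace_nest b) RaQb.
    by split=> // Qs; apply: sRQ; apply/seteqP.
  exists (Rspace a); split=> //.
    by move=> w /Rspace_ker ->; rewrite normr0 mulr_ge0// ltW.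
  have [_] := cor _ NsR RsR sRQb; apply: tbounded_perp_le => //.
    exact: nest_pred_nest.
  exact: nest_pred_succ.
(* Otherwise every nest element above R_a contains Q_b, which gives Q_b inside R_a+ = R_a. *)
have [P0 [NP0 [RP0 P0Q]]] : exists P, N P /\ (Rspace a `<` P /\ P `<` Qspace b).
  apply: contrapT => noP; case: RaQb => _; apply; apply: subset_trans sRR.
  move=> x Qx P [NP RP]; apply: contrapT => Px; apply: noP; exists P; split=> //.
  by split=> //; apply: nest_lt_not => // QP; apply: Px; exact: QP.
have [ta tb] := cor _ NP0 RP0 P0Q.
have {}ta : tbounded (restr_ball P0) a.
  by apply: tbounded_restr_le ta; exact: nest_succ_ge.
have [P [NP RP PP0 aP]] := small_above _ _ _ NRa sRR (Rspace_ker a) NP0 RP0 ta _ e0.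
have PQ : P `<` Qspace b.
  case: P0Q => P0Q QP0; split; first exact: subset_trans P0Q.
  by move=> QP; apply: QP0; exact: subset_trans PP0.
exists P; split=> //; have [_] := cor _ NP RP PQ.
by apply: tbounded_perp_le => //; [exact: nest_pred_nest|exact: nest_pred_le].
Qed.

Lemma corners_high : nest_succ N (Rspace a) <> Qspace b -> compact_corners ->
  forall e, 0 < e -> exists P, [/\ N P,
    forall v, `|v| <= 1 -> `|oproj_perp P (b v)| <= e &
    tbounded (restr_ball P) a].
Proof.
move=> sRQ /corners_tbounded cor e e0.
have NRa := Rspace_nest a; have NQb := Qspace_nest b.
have NpQ := nest_pred_nest (Qspace b); have pQ := nest_pred_le _ NQb.
have [Qp|Qp] := pselect (Qspace b `<=` nest_pred N (Qspace b)); last first.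
  have Qsp := nest_succ_pred _ NQb.
  (* Equality of R_a with the predecessor of Q_b would force R_a+ = Q_b, the excluded case. *)
  have RpQ : Rspace a `<` nest_pred N (Qspace b).
    split; first exact: nest_pred_ge.
    move=> pR; apply: sRQ; have RpE : Rspace a = nest_pred N (Qspace b).
      by apply/seteqP; split=> //; exact: nest_pred_ge.
    by apply/seteqP; split; [exact: nest_succ_le|rewrite RpE].
  exists (Qspace b); split=> //.
    move=> v _; rewrite (oproj_perp_eq0 (nest_cl NQb) _).2 ?normr0 ?ltW//.
    exact: Qspace_range.
  have [ta _] := cor _ NpQ RpQ (conj pQ Qp).
  exact: tbounded_restr_le ta.
have [P0 [NP0 [RP0 P0Q]]] : exists P, N P /\ (Rspace a `<` P /\ P `<` Qspace b).
  apply: contrapT => noP; case: RaQb => _; apply; apply: subset_trans Qp _.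
  apply: nest_vee_lub => // P [NP PQ]; apply: contrapT => PR; apply: noP.
  by exists P; split=> //; split=> //; exact: nest_lt_not.
have [_ tb] := cor _ NP0 RP0 P0Q.
have {}tb : tbounded (@unit_ball _ H) (fun v => oproj_perp P0 (b v)).
  by apply: tbounded_perp_le tb => //; [exact: nest_pred_nest|exact: nest_pred_le].
have [P [NP P0P PQ bP]] := small_below _ _ NP0 P0Q Qp tb _ e0.
have RP : Rspace a `<` P.
  case: RP0 => RP0 P0R; split; first exact: subset_trans P0P.
  by move=> PR; apply: P0R; exact: subset_trans PR.
exists P; split=> //; have [ta _] := cor _ NP RP PQ.
by apply: tbounded_restr_le ta; exact: nest_succ_ge.
Qed.

End Multiplication.

End NestOrder.

Theorem theorem2p2 (R : realType) (H : hilbertType R) (N : nest H)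
    (a b : alg N) (Mab_neq0 : mulop a b <> cst 0) :
  (nest_succ N (Rspace a) <> Qspace b ->
    (compact_op (mulop a b) <->
     forall P : set H, N P -> Rspace a `<` P -> P `<` Qspace b ->
       compact_op (corner (oproj (nest_succ N P)) a) /\
       compact_op (corner (oproj_perp (nest_pred N P)) b)))
  /\
  (nest_succ N (Rspace a) = Qspace b ->
    (compact_op (mulop a b) <->
     compact_op (corner (oproj (Qspace b)) a) /\
     compact_op (corner (oproj_perp (Rspace a)) b))).
Proof.
have RQ := Rspace_lt_Qspace _ _ Mab_neq0.
have NR := Rspace_nest a; have NQ := Qspace_nest b.
split=> sRQ; split.
- move=> cM P NP RP PQ; split.
    exact: compact_mulop_left (pred_le_nest_succ _ NP) PQ cM.
  exact: compact_mulop_right (pred_le_nest_pred _ NP) RP cM.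
- move=> cor; apply/compact_mulop; apply: mulop_tbounded.
    exact: corners_low.
  exact: corners_high.
(* When R_a+ = Q_b the single pair (Q_b, R_a) yields both corners. *)
- have RL : pred_le (N := N) (Qspace b) (Rspace a).
    by rewrite -sRQ; exact: pred_le_nest_succ.
  move=> cM; split; first exact: compact_mulop_left RL RQ cM.
  exact: compact_mulop_right RL RQ cM.
move=> [/(compact_corner_left _ _ NQ) ca /(compact_corner_right _ _ NR) cb].
apply/compact_mulop; apply: mulop_tbounded => e e0.
  exists (Rspace a); split=> //.
  by move=> w /Rspace_ker ->; rewrite normr0 mulr_ge0// ltW.
exists (Qspace b); split=> //.
move=> v _; rewrite (oproj_perp_eq0 (nest_cl NQ) _).2 ?normr0 ?ltW//.
exact: Qspace_range.
Qed.
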